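(* Let $u,v\in\mathcal{R}$. Then the size (number of vertices) of the conjugacy decision tree $T_{u,v}$ is bounded by $2^{366}\left(\max\{2|u|,2|v|\}\right)^{7}$.
   Context: Words are over the alphabet $X=\{a,b,c,d\}$; $|w|$ is the length of $w$ and $|w|_a$ the number of occurrences of $a$ in $w$. For a word $w$, $red(w)$ is the unique normal form of $w$ under the terminating confluent rewriting system $xx\to\varepsilon$ ($x\in X$) and $rs\to t$ (where $\{r,s,t\}=\{b,c,d\}$, i.e. $r,s,t$ pairwise distinct). $\mathcal{R}$ is the set of all reduced words (words in which occurrences of $a$ alternate with letters from $\{b,c,d\}$, including the empty word $\varepsilon$). Splitting: for a word $w$ with $|w|_a$ even, define words $\psi_0(w),\psi_1(w)$ as follows. Read $w$ from left to right; each occurrence of a letter $x\in\{b,c,d\}$ preceded in $w$ by an even number of $a$'s contributes to $(\psi_0,\psi_1)$ the pair $b\mapsto(a,c)$, $c\mapsto(a,d)$, $d\mapsto(\varepsilon,b)$; each occurrence preceded by an odd number of $a$'s contributes $b\mapsto(c,a)$, $c\mapsto(d,a)$, $d\mapsto(b,\varepsilon)$; letters $a$ contribute nothing. $\psi_0(w)$ is the concatenation of the first components of these contributions, and $\psi_1(w)$ the concatenation of the second components. Tree $T_{u,v}$: a finite rooted tree whose vertices are labeled by pairs of words from $\mathcal{R}$ (different vertices may carry equal labels), with root labeled $(u,v)$. A vertex labeled $(u',v')$ is treated as follows. - If $|u'|\le1$ and $|v'|\le1$, it is a leaf. - Otherwise, if exactly one of $|u'|_a,|v'|_a$ is even, it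 is a leaf. - Otherwise, if $|u'|_a$ and $|v'|_a$ are both even, put $u'_i=red(\psi_i(u'))$, $v'_i=red(\psi_i(v'))$ for $i=0,1$; the vertex has four children labeled $(u'_0,v'_0)$, $(u'_1,v'_1)$, $(u'_0,v'_1)$, $(u'_1,v'_0)$. - Otherwise, $|u'|_a$ and $|v'|_a$ are both odd; put $u'_i=red(\psi_i(u'a))$, $v'_i=red(\psi_i(v'a))$ for $i=0,1$; the vertex has two children labeled $(red(u'_0u'_1),red(v'_0v'_1))$ and $(red(u'_1u'_0),red(v'_0v'_1))$.
   Formalization: The pair in which u and v are both the empty word is excluded: there the tree has one vertex (its root) while the stated bound equals 0, so the claim fails for exactly that pair. *)

(* Defs.v *)
From HB Require Import structures.
From mathcomp Require Import all_boot.
From Stdlib Require Import Relation_Operators.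

Set Implicit Arguments.
Unset Strict Implicit.
Unset Printing Implicit Defensive.

Inductive letter := La | Lb | Lc | Ld.

Definition letter_eqb (x y : letter) : bool :=
  match x, y with
  | La, La | Lb, Lb | Lc, Lc | Ld, Ld => true
  | _, _ => false
  end.

Lemma letter_eqbP : Equality.axiom letter_eqb.
Proof. by case; case; constructor. Qed.

HB.instance Definition _ := hasDecEq.Build letter letter_eqbP.

Definition word := seq letter.

Inductive rewrite_step : word -> word -> Prop :=
| step_square p x q : rewrite_step (p ++ [:: x; x] ++ q) (p ++ q)
| step_klein p r s t q :
    perm_eq [:: r; s; t] [:: Lb; Lc; Ld] ->
    rewrite_step (p ++ [:: r; s] ++ q) (p ++ [:: t] ++ q).

Definition rewrites : word -> word -> Prop := clos_refl_trans word rewrite_step.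

Definition normal (w : word) : Prop := forall w', ~ rewrite_step w w'.

(* Among any two adjacent letters, exactly one is [La]. *)
Definition reduced (w : word) : bool :=
  sorted (fun x y => (x == La) != (y == La)) w.

(* The third letter of {b,c,d}; only meaningful for distinct r, s in {b,c,d}. *)
Definition third (r s : letter) : letter :=
  match r, s with
  | Lb, Lc | Lc, Lb => Ld
  | Lb, Ld | Ld, Lb => Lc
  | _, _ => Lb
  end.

(* Normal form of [x :: w] for [w] already in normal form. *)
Definition red_cons (x : letter) (w : word) : word :=
  if w is y :: w' then
    if x == y then w'
    else if (x == La) || (y == La) then x :: w
    else third x y :: w'
  else [:: x].

(* [red w] is the unique normal form of [w]: see [red_rewrites], [red_normal]
   and [red_unique]. *)
Definition red (w : word) : word := foldr red_cons [::] w.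

Lemma reduced_red w : reduced (red w).
Proof.
elim: w => [//|x w]; rewrite /= -/(red w).
by case: (red w) => [|y [|z w']] //=; case: x; case: y; try case: z.
Qed.

Lemma red_id w : reduced w -> red w = w.
Proof.
elim: w => [//|x w IH] /= rxw; rewrite -/(red w) IH; last exact: path_sorted rxw.
by case: w rxw {IH} => [|y w] //=; case: x; case: y.
Qed.

Lemma normal_reduced w : normal w <-> reduced w.
Proof.
split=> [|rw w' st].
  elim: w => [//|x w IH] nw.
  have {}IH: reduced w.
    apply: IH => w' st; case: st nw => [p y q|p r s t q E] nw.
      by apply: (nw (x :: p ++ q)); apply: (step_square (x :: p)).
    by apply: (nw (x :: p ++ [:: t] ++ q)); apply: (step_klein (x :: p)).
  case: w IH nw => [//|y w] /= -> nw; rewrite andbT.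
  have neq : x != y.
    by apply/eqP => E; subst; apply: (nw w); exact: (step_square [::]).
  apply/negP => /eqP E.
  apply: (nw (third x y :: w)); apply: (step_klein [::]).
  by case: x y E neq {nw} => [] [].
case: st rw => [p x q|p r s t q E]; rewrite /reduced;
  case/cat_sorted2 => _ /=; first by rewrite eqxx.
by move: E; case: r; case: s; case: t.
Qed.

Lemma red_normal w : normal (red w).
Proof. exact/normal_reduced/reduced_red. Qed.

Lemma rewrites_cons x w w' : rewrites w w' -> rewrites (x :: w) (x :: w').
Proof.
elim=> {w w'} [w w' st|w|w1 w2 w3 _ IH1 _ IH2].
- apply: rt_step; case: st => [p y q|p r s t q E].
    exact: (step_square (x :: p)).
  exact: (step_klein (x :: p)).
- exact: rt_refl.
- exact: rt_trans IH1 IH2.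
Qed.

Lemma red_rewrites w : rewrites w (red w).
Proof.
elim: w => [|x w IH]; first exact: rt_refl.
apply: rt_trans (rewrites_cons x IH) _ => /=; rewrite -/(red w).
case: (red w) => [|y w'] /=; first exact: rt_refl.
case: eqP => [->|/eqP neq]; first exact/rt_step/(step_square [::]).
case: ifP => [_|nLa]; first exact: rt_refl.
apply/rt_step/(step_klein [::]).
by case: x y neq nLa => [] [].
Qed.

Lemma red_step w w' : rewrite_step w w' -> red w = red w'.
Proof.
case=> [p x q|p r s t q E]; rewrite /red !foldr_cat; congr foldr => /=;
  rewrite -/(red q); have := reduced_red q; case: (red q) => [|y [|z l]] //=.
all: try by case: x.
all: try by case: x; case: y.
all: try by case: x; case: y; case: z.
all: try by move: E; case: r; case: s; case: t.
all: try by move: E; case: r; case: s; case: t => //; case: y.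
by move: E; case: r; case: s; case: t => //; case: y => //; case: z.
Qed.

Lemma red_unique w w' : rewrites w w' -> normal w' -> w' = red w.
Proof.
move=> ww' /normal_reduced/red_id {1}<-.
by elim: ww' => // [x y /red_step //|x y z _ IH1 _ IH2]; rewrite IH2.
Qed.

(* The pair contributed by an occurrence of a letter of {b,c,d}; [after_odd] says
   whether it is preceded by an odd number of occurrences of [La]. *)
Definition contribution (after_odd : bool) (x : letter) : word * word :=
  match after_odd, x with
  | _, La => ([::], [::])
  | false, Lb => ([:: La], [:: Lc])
  | false, Lc => ([:: La], [:: Ld])
  | false, Ld => ([::], [:: Lb])
  | true, Lb => ([:: Lc], [:: La])
  | true, Lc => ([:: Ld], [:: La])
  | true, Ld => ([:: Lb], [::])
  end.

Fixpoint contributions (after_odd : bool) (w : word) : seq (word * word) :=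
  if w is x :: w' then
    contribution after_odd x :: contributions (after_odd (+) (x == La)) w'
  else [::].

Definition psi0 (w : word) : word := flatten (unzip1 (contributions false w)).
Definition psi1 (w : word) : word := flatten (unzip2 (contributions false w)).

Inductive tree := Node of word * word & seq tree.

Fixpoint tree_size (t : tree) : nat :=
  let: Node _ ts := t in (sumn (map tree_size ts)).+1.

Definition odd_a (w : word) : bool := odd (count_mem La w).

Definition short (u v : word) : bool := (size u <= 1) && (size v <= 1).

(* [is_T u v t] : t is the tree T_{u,v}. Being inductive, trees are finite, so
   that for given u, v the existence of such a t says that the recursive
   description of T_{u,v} terminates; uniqueness is [is_T_unique]. *)
Inductive is_T : word -> word -> tree -> Prop :=
| T_short u v :
    short u v -> is_T u v (Node (u, v) [::])
| T_parity u v :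
    ~~ short u v -> odd_a u != odd_a v -> is_T u v (Node (u, v) [::])
| T_even u v t00 t11 t01 t10 :
    ~~ short u v -> ~~ odd_a u -> ~~ odd_a v ->
    let u0 := red (psi0 u) in let u1 := red (psi1 u) in
    let v0 := red (psi0 v) in let v1 := red (psi1 v) in
    is_T u0 v0 t00 -> is_T u1 v1 t11 -> is_T u0 v1 t01 -> is_T u1 v0 t10 ->
    is_T u v (Node (u, v) [:: t00; t11; t01; t10])
| T_odd u v t01 t10 :
    ~~ short u v -> odd_a u -> odd_a v ->
    let u0 := red (psi0 (rcons u La)) in let u1 := red (psi1 (rcons u La)) in
    let v0 := red (psi0 (rcons v La)) in let v1 := red (psi1 (rcons v La)) in
    is_T (red (u0 ++ u1)) (red (v0 ++ v1)) t01 ->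
    is_T (red (u1 ++ u0)) (red (v0 ++ v1)) t10 ->
    is_T u v (Node (u, v) [:: t01; t10]).

Lemma is_T_unique u v t t' : is_T u v t -> is_T u v t' -> t = t'.
Proof.
move=> Tt; elim: Tt t' => {u v t}
    [u v sh|u v sh ne|u v t00 t11 t01 t10 sh ou ov u0 u1 v0 v1 _ I00 _ I11 _ I01
    _ I10|u v t01 t10 sh ou ov u0 u1 v0 v1 _ I01 _ I10] t' Tt';
  inversion Tt'; subst; try by
    [ do ?match goal with H : is_true _ |- _ => move: H; clear H end;
      case: (short u v); case: (odd_a u); case: (odd_a v)].
- by congr (Node _ [:: _; _; _; _]); [apply: I00|apply: I11|apply: I01|apply: I10].
- by congr (Node _ [:: _; _]); [apply: I01|apply: I10].
Qed.

(* For u = v = empty word, T_{u,v} is a single vertex while the bound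
   2^366 (max {2|u|, 2|v|})^7 is 0: this pair has to be excluded. *)
Lemma is_T_nil t : is_T [::] [::] t -> tree_size t = 1.
Proof. by move/is_T_unique/(_ (@T_short [::] [::] isT)) ->. Qed.

(* Main.v *)
(** Give the letters a, b, c, d the weights 19, 17, 11, 6 and let N(w) be the
    total weight of w.  These satisfy the triangle inequalities within {b,c,d},
    so [red] does not increase N.  With q = 5/6 they also satisfy
    a+c = q(a+b), a+d = q(a+c), b <= q^2(a+d), whence for reduced w, in which the
    letters b, c, d outnumber a by at most one, N(psi_0 w) + N(psi_1 w) <=
    q(N(w) + 19), while each psi_i alone satisfies N(psi_i w) <= q^2(N(w) + 19).
    Thus N - 95 shrinks by q at an odd vertex, which has 2 children, and by q^2
    at an even vertex, which has 4.  Hence a pair with N - 95 <= q^-k has fewer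
    than 2^k M descendants, M bounding the trees of the pairs with N <= 96; these
    consist of words of length at most 7, all of whose descendants have length
    at most 1 after five steps.  Finally 2 <= q^-4, so that 2^k is at most of
    order n^4. *)
Require Import Defs.
From mathcomp Require Import all_boot.
From mathcomp Require Import zify.

(** Both coordinates of a child label are children of the parent's coordinates, so norms can be
    bounded one word at a time. *)
Definition children (w : word) : seq word :=
  if odd_a w then
    let w0 := red (psi0 (rcons w La)) in let w1 := red (psi1 (rcons w La)) in
    [:: red (w0 ++ w1); red (w1 ++ w0)]
  else [:: red (psi0 w); red (psi1 w)].

Lemma children_reduced w w' : w' \in children w -> reduced w'.
Proof.
by rewrite /children; case: odd_a; rewrite !inE => /orP[] /eqP ->;
  exact: reduced_red.
Qed.

(** The strict bound absorbs the root: $1 + 4(m-1) < 4m$ and $1 + 2(m-1) < 2m$. *)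
Definition tree_below (m : nat) (u v : word) : Prop :=
  exists2 t, is_T u v t & tree_size t < m.

Lemma tree_below_weaken m m' u v :
  m <= m' -> tree_below m u v -> tree_below m' u v.
Proof. by move=> mm' [t Tt tm]; exists t => //; apply: leq_trans mm'. Qed.

Lemma tree_below_short u v : short u v -> tree_below 2 u v.
Proof. by exists (Node (u, v) [::]) => //; apply: T_short. Qed.

Lemma tree_below_parity u v : odd_a u != odd_a v -> tree_below 2 u v.
Proof.
move=> ne; case: (boolP (short u v)) => [/tree_below_short //|sh].
by exists (Node (u, v) [::]) => //; apply: T_parity.
Qed.

Lemma tree_below_even m u v : 0 < m -> ~~ odd_a u -> ~~ odd_a v ->
  {in children u & children v, forall u' v', tree_below m u' v'} ->
  tree_below (4 * m) u v.
Proof.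
move=> m0 eu ev.
case: (boolP (short u v)) => [sh _|sh].
  by apply: tree_below_weaken (tree_below_short _ _ sh); lia.
rewrite /children (negPf eu) (negPf ev) => H.
have [||t00 T00 L00] := H (red (psi0 u)) (red (psi0 v)); rewrite ?inE ?eqxx ?orbT //.
have [||t11 T11 L11] := H (red (psi1 u)) (red (psi1 v)); rewrite ?inE ?eqxx ?orbT //.
have [||t01 T01 L01] := H (red (psi0 u)) (red (psi1 v)); rewrite ?inE ?eqxx ?orbT //.
have [||t10 T10 L10] := H (red (psi1 u)) (red (psi0 v)); rewrite ?inE ?eqxx ?orbT //.
exists (Node (u, v) [:: t00; t11; t01; t10]); first exact: T_even.
rewrite /=; lia.
Qed.

Lemma tree_below_odd m u v : 0 < m -> odd_a u -> odd_a v ->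
  {in children u & children v, forall u' v', tree_below m u' v'} ->
  tree_below (2 * m) u v.
Proof.
move=> m0 ou ov.
case: (boolP (short u v)) => [sh _|sh].
  by apply: tree_below_weaken (tree_below_short _ _ sh); lia.
rewrite /children ou ov /=.
set u0 := red (psi0 (rcons u La)); set u1 := red (psi1 (rcons u La)).
set v0 := red (psi0 (rcons v La)); set v1 := red (psi1 (rcons v La)) => H.
have [||t01 T01 L01] := H (red (u0 ++ u1)) (red (v0 ++ v1));
  rewrite ?inE ?eqxx ?orbT //.
have [||t10 T10 L10] := H (red (u1 ++ u0)) (red (v0 ++ v1));
  rewrite ?inE ?eqxx ?orbT //.
exists (Node (u, v) [:: t01; t10]); first exact: T_odd.
rewrite /=; lia.
Qed.

(* All descendants of [w] at depth exactly [k] have length at most 1. *)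
Fixpoint collapses (k : nat) (w : word) : bool :=
  if k is k'.+1 then all (collapses k') (children w) else size w <= 1.

Lemma collapses_tree_below k u v :
  collapses k u -> collapses k v -> tree_below (2 * 4 ^ k) u v.
Proof.
elim: k u v => [|k IH] u v /=.
  by move=> su sv; apply: tree_below_short; rewrite /short su.
move=> /allP cu /allP cv.
have pos : 0 < 2 * 4 ^ k by rewrite muln_gt0 expn_gt0.
have H : {in children u & children v, forall u' v', tree_below (2 * 4 ^ k) u' v'}.
  by move=> u' v' /cu cu' /cv; apply: IH.
case: (eqVneq (odd_a u) (odd_a v)) => [|ne]; last first.
  by apply: tree_below_weaken (tree_below_parity _ _ ne); rewrite expnS; lia.
case ou: (odd_a u) => /esym ov.
  apply: tree_below_weaken (tree_below_odd _ _ _ pos ou ov H).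
  by rewrite expnS; lia.
apply: tree_below_weaken (tree_below_even _ _ _ pos (negbT ou) (negbT ov) H).
by rewrite expnS; lia.
Qed.

Fixpoint all_words (n : nat) (P : pred word) : bool :=
  P [::] && (if n is n'.+1 then
    all (fun x => all_words n' (fun w => P (x :: w))) [:: La; Lb; Lc; Ld]
  else true).

Lemma all_wordsP n P w : all_words n P -> size w <= n -> P w.
Proof.
elim: n P w => [|n IH] P [|x w] //= /andP[// _ /and5P[Ha Hb Hc Hd _]] sw.
by case: x; apply: (IH (fun w => P (_ :: w))).
Qed.

Lemma collapses_small w : reduced w -> size w <= 7 -> collapses 5 w.
Proof.
move=> rw sw.
(* Exhaustive check; [if] instead of [==>] keeps call-by-value evaluation from running [collapses]
   on unreduced words. *)
have /all_wordsP/(_ sw) : all_words 7 (fun w => if reduced w then collapses 5 w else true).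
  by vm_compute.
by rewrite rw.
Qed.

Definition weight (x : letter) : nat :=
  match x with La => 19 | Lb => 17 | Lc => 11 | Ld => 6 end.

Definition norm (w : word) : nat := sumn (map weight w).

Lemma norm_cat w w' : norm (w ++ w') = norm w + norm w'.
Proof. by rewrite /norm map_cat sumn_cat. Qed.

Lemma norm_red w : norm (red w) <= norm w.
Proof.
elim: w => [//|x w IH].
apply: (@leq_trans (weight x + norm (red w))); last by rewrite leq_add2l.
rewrite /= -/(red w); case: (red w) => [|y w'] //=.
by case: x; case: y; rewrite /norm /=; lia.
Qed.

Lemma norm_size w : norm w <= 19 * size w.
Proof. by elim: w => [//|x w]; rewrite /norm /=; case: x => /=; lia. Qed.

(** Letters alternate; the term for the head records which kind comes first, so that the induction
    goes through. *)
Lemma reduced_balanced w : reduced w ->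
  count_mem La w <= count (predC1 La) w + (ohead w == Some La) /\
  count (predC1 La) w + (ohead w == Some La) <= (count_mem La w).+1.
Proof.
elim: w => [//|x w IH] rxw.
have {IH} := IH (path_sorted rxw).
case: w rxw => [|y w] /=; first by case: x.
by case/andP => + _; case: x; case: y => //= _; lia.
Qed.

(** By alternation, eight letters include at least four [La], so they weigh at least $4\cdot 19 +
    4\cdot 6 = 100$. *)
Lemma norm_small w : reduced w -> norm w <= 96 -> size w <= 7.
Proof.
move=> /reduced_balanced[_ H1] H.
have E : size w = count_mem La w + count (predC1 La) w.
  by rewrite -(count_predC (pred1 La)).
have : 19 * count_mem La w + 6 * count (predC1 La) w <= norm w.
  by elim: w {H H1 E} => [//|x w]; rewrite /norm /=; case: x => /=; lia.
lia.
Qed.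

Lemma contributions_rcons p w :
  flatten (unzip1 (contributions p (rcons w La))) = flatten (unzip1 (contributions p w))
  /\ flatten (unzip2 (contributions p (rcons w La))) = flatten (unzip2 (contributions p w)).
Proof.
elim: w p => [|x w IH] p /=; first by case: p.
by case: (IH (p (+) (x == La))) => -> ->.
Qed.

(** Checked letter by letter. An [La] gives equality, as $95 = 5\cdot 19$ and $475 = 25\cdot 19$;
    these terms stand on the left to avoid subtraction. Balance later reduces the excess to a single
    19. *)
Lemma norm_contributions p w :
  let w0 := flatten (unzip1 (contributions p w)) in
  let w1 := flatten (unzip2 (contributions p w)) in
  [/\ 6 * (norm w0 + norm w1) + 95 * count_mem La w
        <= 5 * (norm w + 19 * count (predC1 La) w),
      36 * norm w0 + 475 * count_mem La w
        <= 25 * (norm w + 19 * count (predC1 La) w) &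
      36 * norm w1 + 475 * count_mem La w
        <= 25 * (norm w + 19 * count (predC1 La) w)].
Proof.
elim: w p => [//|x w IH] p /=.
case: (IH (p (+) (x == La))); rewrite !norm_cat.
move: (flatten (unzip1 _)) (flatten (unzip2 _)) => w0 w1.
rewrite /norm; case: p; case: x => /= H0 H1 H2; split; lia.
Qed.

Lemma norm_children_odd w w' : reduced w -> odd_a w -> w' \in children w ->
  6 * norm w' <= 5 * (norm w + 19).
Proof.
move=> /reduced_balanced[_ bal] ow; rewrite /children ow /psi0 /psi1.
have [-> ->] := contributions_rcons false w.
have [] := norm_contributions false w.
move: (flatten (unzip1 _)) (flatten (unzip2 _)) => w0 w1 H _ _.
have := norm_red w0; have := norm_red w1.
have := norm_red (red w0 ++ red w1); have := norm_red (red w1 ++ red w0).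
by rewrite !norm_cat !inE => ? ? ? ? /orP[] /eqP ->; lia.
Qed.

Lemma norm_children_even w w' : reduced w -> ~~ odd_a w -> w' \in children w ->
  36 * norm w' <= 25 * (norm w + 19).
Proof.
move=> /reduced_balanced[_ bal] /negPf ew; rewrite /children ew.
have [_ H0 H1] := norm_contributions false w.
have := norm_red (psi0 w); have := norm_red (psi1 w).
by rewrite /psi0 /psi1 !inE => ? ? /orP[] /eqP ->; lia.
Qed.

Lemma tree_below_base u v : reduced u -> reduced v ->
  norm u <= 96 -> norm v <= 96 -> tree_below (2 ^ 11) u v.
Proof.
move=> ru rv nu nv; apply: (collapses_tree_below 5); apply: collapses_small => //;
  exact: norm_small.
Qed.

(** The hypotheses say $N - 95 \le (6/5)^k$ with denominators cleared, 95 being the fixed point of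
    $x \mapsto 5(x+19)/6$. Induction is strong because an even vertex lowers $k$ by 2. *)
Lemma tree_below_level k u v : reduced u -> reduced v ->
  5 ^ k * norm u <= 5 ^ k * 95 + 6 ^ k -> 5 ^ k * norm v <= 5 ^ k * 95 + 6 ^ k ->
  tree_below (2 ^ k * 2 ^ 11) u v.
Proof.
have [n] := ubnP k; elim: n k u v => // n IH [|[|k]] u v kn ru rv nu nv.
(* Both $k = 0$ and $k = 1$ force the norms to be at most 96. *)
- by rewrite mul1n; apply: tree_below_base => //; lia.
- apply: (@tree_below_weaken (2 ^ 11)); first lia.
  by apply: tree_below_base => //; lia.
have pos i : 0 < 2 ^ i * 2 ^ 11 by rewrite muln_gt0 !expn_gt0.
case: (eqVneq (odd_a u) (odd_a v)) => [|ne]; last first.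
  by apply: tree_below_weaken (tree_below_parity _ _ ne);
  rewrite expnS -mulnA leq_pmulr.
case ou: (odd_a u) => /esym ov.
  rewrite expnS -mulnA; apply: tree_below_odd => // u' v' cu cv.
  apply: IH; rewrite ?(children_reduced _ _ cu) ?(children_reduced _ _ cv) //.
    have := norm_children_odd _ _ ru ou cu; move: nu; rewrite !expnS.
    nia.
  have := norm_children_odd _ _ rv ov cv; move: nv; rewrite !expnS.
  nia.
rewrite (_ : 2 ^ k.+2 * 2 ^ 11 = 4 * (2 ^ k * 2 ^ 11)); last by rewrite !expnS; lia.
apply: tree_below_even; rewrite ?ou ?ov // => u' v' cu cv.
apply: IH; rewrite ?(children_reduced _ _ cu) ?(children_reduced _ _ cv) //; first lia.
  have := norm_children_even _ _ ru (negbT ou) cu; move: nu; rewrite !expnS.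
  nia.
have := norm_children_even _ _ rv (negbT ov) cv; move: nv; rewrite !expnS.
nia.
Qed.

Theorem proposition4p5 (u v : word) :
  reduced u -> reduced v -> (u, v) <> ([::], [::]) ->
  exists t : tree, is_T u v t /\
    tree_size t <= 2 ^ 366 * maxn (2 * size u) (2 * size v) ^ 7.
Proof.
move=> ru rv uv.
set n := maxn (size u) (size v).
have n0 : 0 < n.
  by rewrite /n leq_max; case: u v uv {n ru rv} => [|x u] [|y v].
rewrite -maxnMr -/n.
(* $19n$ bounds both norms, and level $4j$ suffices since $2^j \le (6/5)^{4j}$. *)
set j := up_log 2 (19 * n).
have le_j : 19 * n <= 2 ^ j by apply: up_logP.
have j_le : 2 ^ j <= 19 * (2 * n).
  have /andP[+ _] := @up_log_bounds 2 (19 * n) isT ltac:(lia).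
  have : 0 < j by rewrite up_log_gt0; lia.
  by rewrite -/j; case: (j) => //= i _; rewrite expnS; lia.
have norm_le w : size w <= n ->
    5 ^ (4 * j) * norm w <= 5 ^ (4 * j) * 95 + 6 ^ (4 * j).
  move=> wn; apply: leq_trans (leq_addl _ _).
  apply: (@leq_trans (5 ^ (4 * j) * 2 ^ j)).
    by rewrite leq_mul2l; apply/orP; right; have := norm_size w; lia.
  (* Here $5^4\cdot 2 = 1250 \le 1296 = 6^4$. *)
  by rewrite !expnM -expnMn; case: (j) => // i; rewrite leq_exp2r.
have [t Tt lt] := tree_below_level _ _ _ ru rv
  (norm_le u (leq_maxl _ _)) (norm_le v (leq_maxr _ _)).
exists t; split=> //; apply: leq_trans (ltnW lt) _.
apply: (@leq_trans ((19 * (2 * n)) ^ 4 * 2 ^ 11)).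
  by rewrite leq_mul2r mulnC expnM leq_exp2r // j_le orbT.
(* It remains to see $19^4\cdot 2^{11} \le 2^{366}$, which follows from $19 \le 2^5$. *)
rewrite expnMn mulnAC; apply: leq_mul; last by rewrite leq_pexp2l //; lia.
apply: (@leq_trans (2 ^ 20 * 2 ^ 11)).
  by rewrite leq_mul2r; apply/orP; right; rewrite (expnM 2 5 4) leq_exp2r.
by rewrite -expnD leq_exp2l.
Qed.
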